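(* Let $M=M_1\times_fM_2$ be a Lyra twisted warped product of dimension $n$ with metric $g=g_1\oplus f^2g_2$, scale $\varphi$, $\sigma=\ln\varphi$ and $g_L=e^{2\sigma}g$. Let $u,\lambda\in C^\infty(M)$, $\rho\in\mathbb R$, and set $$\Psi_{u,\sigma}=\langle\nabla u,\nabla\sigma\rangle_g-\Delta\sigma-(n-2)|\nabla\sigma|_g^2 .$$ Then the gradient Lyra almost Ricci--Bourguignon equation $$\operatorname{Ric}^L+\operatorname{Hess}^Lu=(\lambda+\rho R^L)g_L$$ is equivalent to $$\operatorname{Ric}+\operatorname{Hess}u-(n-2)\operatorname{Hess}\sigma+(n-2)d\sigma\otimes d\sigma-du\otimes d\sigma-d\sigma\otimes du+\Psi_{u,\sigma}\,g=e^{2\sigma}(\lambda+\rho R^L)\,g .$$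
   Context: Lyra twisted warped product: $(M_1,g_1),(M_2,g_2)$ are smooth pseudo-Riemannian manifolds of positive dimensions $n_1,n_2$, $n=n_1+n_2$; $f,\varphi:M_1\times M_2\to(0,\infty)$ are smooth; $M=M_1\times M_2$ carries $g=g_1\oplus f^2g_2$ and $g_L=\varphi^2g$. $\operatorname{Ric}^L,R^L,\operatorname{Hess}^L$ are the Ricci tensor, scalar curvature and Hessian of $g_L$; $\operatorname{Ric},\nabla,\operatorname{Hess},\Delta,\langle\cdot,\cdot\rangle_g,|\cdot|_g^2$ are those of $g$ ($\Delta$ is the trace of the Hessian; $|v|_g^2=g(v,v)$). Sign convention: round spheres have positive Ricci curvature. *)

(* Defs.v *)
From HB Require Import structures.
From mathcomp Require Import all_boot all_order all_algebra.
From mathcomp Require Import all_classical all_reals all_analysis.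
Set Implicit Arguments.
Unset Strict Implicit.
Unset Printing Implicit Defensive.
Import Order.TTheory GRing.Theory Num.Theory.
Import numFieldNormedType.Exports.
Local Open Scope classical_set_scope.
Local Open Scope ring_scope.

Fixpoint iter_partial (R : realType) (n : nat) (W : normedModType R)
    (s : seq 'I_n) (h : 'rV[R]_n -> W) : 'rV[R]_n -> W :=
  if s is i :: s' then
    fun x => 'D_(delta_mx 0 i : 'rV[R]_n) (iter_partial s' h) x
  else h.

(* C^oo on an open set U: every iterated partial derivative is Frechet
   differentiable (hence continuous) at every point of U. *)
Definition smooth_on (R : realType) (n : nat) (W : normedModType R)
    (U : set 'rV[R]_n) (h : 'rV[R]_n -> W) : Prop :=
  forall (s : seq 'I_n) (x : 'rV[R]_n),
    U x -> differentiable (iter_partial s h) x.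

(* A topological space with a family of charts: [coord a] sends the open set
   [dom a] into R^n and [param a] is its inverse on [coord a @` dom a]; both
   are total functions that are irrelevant outside these sets.  The axioms are
   in [smooth_manifold]. *)
Record charted_space (R : realType) (n : nat) := ChartedSpace {
  carrier :> topologicalType;
  chart : Type;
  dom : chart -> set carrier;
  coord : chart -> carrier -> 'rV[R]_n;
  param : chart -> 'rV[R]_n -> carrier
}.
Arguments chart {R n} M : rename.
Arguments dom {R n} M a : rename.
Arguments coord {R n} M a : rename.
Arguments param {R n} M a : rename.

Definition image_dom (R : realType) (n : nat) (M : charted_space R n)
    (a : chart M) : set 'rV[R]_n := coord M a @` dom M a.

Definition transition (R : realType) (n : nat) (M : charted_space R n)
    (a b : chart M) : 'rV[R]_n -> 'rV[R]_n := coord M b \o param M a.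

Record smooth_manifold (R : realType) (n : nat) (M : charted_space R n) : Prop :=
  SmoothManifold {
  manifold_hausdorff : hausdorff_space M;
  manifold_second_countable : @second_countable M;
  manifold_cover : forall p : M, exists a : chart M, dom M a p;
  dom_open : forall a : chart M, open (dom M a);
  image_dom_open : forall a : chart M, open (image_dom a);
  coordK : forall (a : chart M) (p : M), dom M a p -> param M a (coord M a p) = p;
  coord_continuous : forall a : chart M,
    {within dom M a, continuous (coord M a)};
  param_continuous : forall a : chart M,
    {within image_dom a, continuous (param M a)};
  transition_smooth : forall a b : chart M,
    smooth_on (coord M a @` (dom M a `&` dom M b)) (transition a b)
}.

Definition smooth_fun (R : realType) (n : nat) (M : charted_space R n)
    (h : M -> R) : Prop :=
  forall a : chart M, smooth_on (image_dom a) (h \o param M a).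

Definition prod_space (R : realType) (n1 n2 : nat)
    (M1 : charted_space R n1) (M2 : charted_space R n2) :
    charted_space R (n1 + n2) :=
  @ChartedSpace R (n1 + n2) (M1 * M2)%type (chart M1 * chart M2)%type
    (fun a => dom M1 a.1 `*` dom M2 a.2)
    (fun a p => row_mx (coord M1 a.1 p.1) (coord M2 a.2 p.2))
    (fun a x => (param M1 a.1 (lsubmx x), param M2 a.2 (rsubmx x))).

(* A covariant 2-tensor field is given by its component matrices in the charts:
   [T a p i j] is T(d_i, d_j) at [p] in the chart [a], and is meaningful only
   for [p] in [dom M a].  The same convention applies to the other objects
   indexed by a chart below, including scalars built from components. *)
Definition tensor2 (R : realType) (n : nat) (M : charted_space R n) : Type :=
  chart M -> M -> 'M[R]_n.

(* The library's Jacobian acts on row vectors: ('J f x) i k is the derivative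
   of the k-th component of f in the i-th direction. *)
Record pseudo_riemannian (R : realType) (n : nat) (M : charted_space R n)
    (g : tensor2 M) : Prop := PseudoRiemannian {
  metric_smooth : forall (a : chart M) (i j : 'I_n),
    smooth_on (image_dom a) (fun x => g a (param M a x) i j);
  metric_transition : forall (a b : chart M) (p : M),
    dom M a p -> dom M b p ->
    let J := jacobian (transition a b) (coord M a p) in
    g a p = J *m g b p *m J^T;
  metric_sym : forall (a : chart M) (p : M), dom M a p -> (g a p)^T = g a p;
  metric_nondegenerate : forall (a : chart M) (p : M),
    dom M a p -> g a p \in unitmx
}.

Section Geometry.
Context (R : realType) (n : nat) (M : charted_space R n).
Implicit Types (a : chart M) (p : M) (u v : M -> R) (g : tensor2 M).

Definition pd a (i : 'I_n) u p : R :=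
  'D_(delta_mx 0 i : 'rV[R]_n) (u \o param M a) (coord M a p).

Definition christoffel g a (k i j : 'I_n) p : R :=
  2^-1 * \sum_(l < n) invmx (g a p) k l *
    (pd a i (fun q => g a q j l) p + pd a j (fun q => g a q i l) p
     - pd a l (fun q => g a q i j) p).

(* R(d_i, d_j) d_k = \sum_l (riemann g a l k i j) d_l, with
   R(X, Y) Z = D_X D_Y Z - D_Y D_X Z - D_[X, Y] Z. *)
Definition riemann g a (l k i j : 'I_n) p : R :=
  pd a i (christoffel g a l j k) p - pd a j (christoffel g a l i k) p
  + \sum_(m < n) (christoffel g a l i m p * christoffel g a m j k p
                  - christoffel g a l j m p * christoffel g a m i k p).

(* Ric(Y, Z) is the trace of X |-> R(X, Y) Z; round spheres have Ric > 0. *)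
Definition ricci g : tensor2 M := fun a p =>
  \matrix_(j < n, k < n) \sum_(i < n) riemann g a i k i j p.

Definition metric_trace g (T : tensor2 M) a p : R :=
  \sum_(i < n) \sum_(j < n) invmx (g a p) i j * T a p i j.

Definition scalar_curvature g a p : R := metric_trace g (ricci g) a p.

Definition hessian g u : tensor2 M := fun a p =>
  \matrix_(i < n, j < n)
    (pd a i (pd a j u) p - \sum_(k < n) christoffel g a k i j p * pd a k u p).

Definition laplacian g u a p : R := metric_trace g (hessian g u) a p.

Definition diff1 u a p : 'rV[R]_n := \row_(i < n) pd a i u p.

Definition otimes (alpha beta : chart M -> M -> 'rV[R]_n) : tensor2 M :=
  fun a p => \matrix_(i < n, j < n) (alpha a p 0 i * beta a p 0 j).

Definition gradient g u a p : 'rV[R]_n :=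
  \row_(k < n) \sum_(l < n) invmx (g a p) k l * pd a l u p.

Definition inner g (X Y : chart M -> M -> 'rV[R]_n) a p : R :=
  \sum_(i < n) \sum_(j < n) g a p i j * X a p 0 i * Y a p 0 j.

Definition Psi g u sigma a p : R :=
  inner g (gradient g u) (gradient g sigma) a p
  - laplacian g sigma a p
  - (n%:R - 2) * inner g (gradient g sigma) (gradient g sigma) a p.

Definition scale_metric (phi : M -> R) g : tensor2 M :=
  fun a p => phi p ^+ 2 *: g a p.

End Geometry.

Definition twisted_metric (R : realType) (n1 n2 : nat)
    (M1 : charted_space R n1) (M2 : charted_space R n2)
    (f : prod_space M1 M2 -> R) (g1 : tensor2 M1) (g2 : tensor2 M2) :
    tensor2 (prod_space M1 M2) :=
  fun a p => block_mx (g1 a.1 p.1) 0 0 (f p ^+ 2 *: g2 a.2 p.2).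

(* Main.v *)
(** Write the Christoffel symbols of g_L = e^(2 sigma) g as Gamma + S with
    S^k_ij = delta^k_j s_i + delta^k_i s_j - g_ij s^k, where s = d sigma and
    s^k = (grad sigma)^k.  Substituting this in the coordinate formula for the
    Ricci tensor, compatibility of Gamma with g turns the terms containing
    derivatives of g into the divergence of grad sigma, and symmetry of the
    second partial derivatives of sigma yields
      Ric_L = Ric - (n - 2) (Hess sigma - d sigma (x) d sigma)
              - (Lap sigma + (n - 2) |grad sigma|^2) g,
    while
      Hess_L u = Hess u - du (x) d sigma - d sigma (x) du
                 + <grad u, grad sigma> g.
    Adding the two, the left-hand sides of the two equations agree at every
    point of every chart; the right-hand sides agree because
    e^(2 sigma) = phi^2. *)

Require Import Defs.
From HB Require Import structures.
From mathcomp Require Import all_boot all_order all_algebra.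
From mathcomp Require Import all_classical all_reals all_analysis.
From mathcomp Require Import ring.
Set Implicit Arguments.
Unset Strict Implicit.
Unset Printing Implicit Defensive.
Import Order.TTheory GRing.Theory Num.Theory.
Import numFieldNormedType.Exports.
Local Open Scope classical_set_scope.
Local Open Scope ring_scope.

(** * Symmetry of second derivatives *)

Lemma is_derive_line (R : realType) (V : normedModType R) (f : V -> R)
    (a v : V) (t : R) : differentiable f (t *: v + a) ->
  is_derive t 1 (fun s : R => f (s *: v + a)) ('D_v f (t *: v + a)).
Proof.
move=> df; have dl : is_diff t (fun s : R => s *: v + a) (fun h => h *: v).
  apply: is_diff_eq; by rewrite funeqE => h /=; rewrite addr0.
have dc : differentiable (f \o (fun s : R => s *: v + a)) t.
  exact: differentiable_comp.
apply: DeriveDef; first exact: diff_derivable.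
rewrite deriveE // (diff_comp (f := fun s : R => s *: v + a)) //=.
by rewrite diff_val scale1r deriveE.
Qed.

(** The little-o in the definition of the differential is unfolded here, so that an explicit radius
    can be extracted from it. *)
Lemma differentiable_expansion (R : realType) (V : normedModType R) (g : V -> R)
    (x : V) (e : R) : differentiable g x -> 0 < e ->
  \forall k \near (0 : V), `|g (k + x) - g x - 'd g x k| <= e * `|k|.
Proof.
move=> dg e0; have /eqaddoP /(_ _ e0) := diff_locally dg.
by apply: filterS => k /=; rewrite /= -[in X in X -> _]/(_ + _) opprD addrA.
Qed.

(* Mean value theorem for t |-> f (x + t v + h w) - f (x + t v).  The second
   difference is symmetric in v and w, whence [derive_comm]. *)
Lemma second_difference (R : realType) (V : normedModType R) (f : V -> R)
    (x v w : V) (e : R) :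
  (\forall y \near x, differentiable f y) -> differentiable ('D_v f) x ->
  0 < e ->
  \forall h \near 0^'+,
    `|f (h *: v + (h *: w + x)) - f (h *: w + x) - f (h *: v + x) + f x
      - h ^+ 2 * 'D_w ('D_v f) x| <= e * h ^+ 2.
Proof.
(* [C] is chosen so that [h * C] bounds every [t *: v + t' *: w] with [t] and [t'] between 0 and
   [h]; the added 1 keeps it positive when [v] and [w] vanish. *)
move=> df dg e0; pose C := `|v| + `|w| + 1.
have C0 : 0 < C by rewrite /C ltr_wpDl // addr_ge0.
(* Two remainders of size [e / (2 * C) * (h * C)], each multiplied by the factor [h] of the mean
   value theorem, add up to [e * h ^+ 2]. *)
have e'0 : 0 < e / (2 * C) by rewrite divr_gt0 // mulr_gt0.
have /nbhs_ballP[r1 /= r10 Hr1] := differentiable_expansion dg e'0.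
have /nbhs_ballP[r2 /= r20 Hr2] := df.
have small (h t t' : R) : 0 <= t <= h -> 0 <= t' <= h ->
    `|t *: v + t' *: w| <= h * C.
  move=> /andP[t0 th] /andP[t'0 t'h]; apply: (le_trans (ler_normD _ _)).
  rewrite !normrZ !ger0_norm // /C !mulrDr mulr1 -[leLHS]addr0.
  by rewrite lerD ?lerD ?ler_wpM2r // (le_trans t0).
near=> h.
have h0 : 0 < h by near: h; exact: nbhs_right_gt.
have hr1 : h * C < r1.
  by rewrite -ltr_pdivlMr //; near: h; apply: nbhs_right_lt; rewrite divr_gt0.
have hr2 : h * C < r2.
  by rewrite -ltr_pdivlMr //; near: h; apply: nbhs_right_lt; rewrite divr_gt0.
have hh : 0 <= h <= h by rewrite lexx ltW.
have h00 : (0 : R) <= 0 <= h by rewrite le_refl ltW.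
have dfl (t t' : R) : 0 <= t <= h -> 0 <= t' <= h ->
    differentiable f (t *: v + (t' *: w + x)).
  move=> th t'h; apply: Hr2; rewrite -ball_normE /= addrA opprD addrCA subrr addr0.
  by rewrite normrN; apply: le_lt_trans (small _ _ _ th t'h) hr2.
(* The term [0 *: w] gives both points the same shape, so that one argument serves for [t' = h] and
   [t' = 0]. *)
pose phi t := f (t *: v + (h *: w + x)) - f (t *: v + (0 *: w + x)).
have dphi (t : R) : 0 <= t <= h -> is_derive t 1 phi
    ('D_v f (t *: v + (h *: w + x)) - 'D_v f (t *: v + (0 *: w + x))).
  by move=> th; apply: is_deriveB; apply: is_derive_line; apply: dfl.
have phiC : {within `[0, h], continuous phi}.
  apply: derivable_within_continuous => s; rewrite in_itv /= => sh.
  by have [] := dphi s sh.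
have phiD (t : R) : t \in `]0, h[%R -> is_derive t 1 phi
    ('D_v f (t *: v + (h *: w + x)) - 'D_v f (t *: v + (0 *: w + x))).
  by rewrite in_itv /= => /andP[t0 th]; apply: dphi; rewrite !ltW.
have [c ch Ec] := MVT h0 phiD phiC.
have {}ch : 0 <= c <= h by move: ch; rewrite in_itv /= => /andP[? ?]; rewrite !ltW.
have est (t' : R) : 0 <= t' <= h ->
    `|'D_v f (c *: v + (t' *: w + x)) - 'D_v f x - 'd ('D_v f) x (c *: v + t' *: w)|
     <= e / 2 * h.
  move=> t'h; rewrite addrA; apply: le_trans.
    apply: (Hr1 (c *: v + t' *: w)); rewrite -ball_normE /= sub0r normrN.
    exact: le_lt_trans (small _ _ _ ch t'h) hr1.
  apply: (@le_trans _ _ (e / (2 * C) * (h * C))).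
    by rewrite ler_wpM2l ?(ltW e'0) ?small.
  by rewrite le_eqVlt; apply/orP; left; apply/eqP; field; rewrite gt_eqF.
have E1 := est _ hh; have E2 := est _ h00.
move: Ec; rewrite /phi !scale0r !add0r subr0 => Ec.
have regroup (a b c' d : R) : a - b - c' + d = a - c' - (b - d) by ring.
rewrite regroup Ec (deriveE w dg).
have lin (t : R) : 'd ('D_v f) x (c *: v + t *: w)
    = c * 'd ('D_v f) x v + t * 'd ('D_v f) x w by rewrite linearD !linearZ.
move: E1 E2; rewrite !lin scale0r add0r mul0r addr0.
set A := 'D_v f _; set B := 'D_v f x; set D := 'D_v f _.
set P := 'd _ _ v; set Q := 'd _ _ w => E1 E2.
(* Once both values of ['D_v f] are expanded at [x], the constant [B] and the part [c * P] cancel.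
   Only [h * Q] survives, so the unknown [c] does no harm. *)
have -> : (A - D) * h - h ^+ 2 * Q
    = h * ((A - B - (c * P + h * Q)) - (D - B - c * P)).
  by move: A B D P Q {E1 E2} => A B D P Q; ring.
rewrite normrM (gtr0_norm h0) (_ : e * h ^+ 2 = h * (e / 2 * h + e / 2 * h));
  last by field.
rewrite ler_wpM2l ?(ltW h0) //; apply: le_trans (ler_normB _ _) _.
by rewrite lerD // -?scale0r.
Unshelve. all: by end_near. Qed.

(** Young's theorem. One second difference lies within [e / 2 * h ^+ 2] of [h ^+ 2] times either
    mixed derivative; dividing by [h ^+ 2] for a single common [h] shows that these differ by at
    most [e]. *)
Lemma derive_comm (R : realType) (V : normedModType R) (f : V -> R) (x v w : V) :
  (\forall y \near x, differentiable f y) ->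
  differentiable ('D_v f) x -> differentiable ('D_w f) x ->
  'D_w ('D_v f) x = 'D_v ('D_w f) x.
Proof.
move=> df dv dw; apply/eqP; rewrite -subr_eq0 -normr_le0.
apply/ler_addgt0Pr => e e0; rewrite add0r.
have e2 : 0 < e / 2 by rewrite divr_gt0.
have S1 := second_difference w df dv e2.
have S2 := second_difference v df dw e2.
have [h [h0 [E1 E2]]] := filter_ex (filterI (nbhs_right_gt (0 : R)) (filterI S1 S2)).
have h2 : 0 < h ^+ 2 by rewrite exprn_gt0.
rewrite -(ler_pM2l h2) -{1}(gtr0_norm h2) -normrM.
move: E1 E2; rewrite (addrCA (h *: v)).
set S := f _; set P := f (_ + x); set Q := f (_ + x) => E1 E2.
have -> : h ^+ 2 * ('D_w ('D_v f) x - 'D_v ('D_w f) x)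
    = (S - Q - P + f x - h ^+ 2 * 'D_v ('D_w f) x)
      - (S - P - Q + f x - h ^+ 2 * 'D_w ('D_v f) x).
  by move: S P Q ('D_w _ x) ('D_v _ x) (f x) {E1 E2} => *; ring.
apply: le_trans (ler_normB _ _) _; apply: le_trans (lerD E2 E1) _.
by rewrite le_eqVlt; apply/orP; left; apply/eqP; field.
Unshelve. all: by end_near. Qed.

(** * Calculus in a chart *)

(** The differential of [f] also gives a first-order expansion of [g], and uniqueness of the
    differential identifies it with that of [g]. *)
Lemma near_eq_differentiable (R : realType) (V W : normedModType R)
    (f g : V -> W) (x : V) :
  {near x, f =1 g} -> differentiable f x -> differentiable g x.
Proof.
move=> fg df; have [dfc _] := (diff_locallyP x f).1 df.
have gE : g \o shift x = cst (g x) + 'd f x +o_ (0 : V) id.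
  apply/eqaddoP => e e0; have /eqaddoP /(_ _ e0) := diff_locally df.
  have : \forall k \near (0 : V), f (k + x) = g (k + x).
    by have := fg; rewrite (near_shift 0 x); apply: filterS => y /=; rewrite subr0.
  apply: filterS2 => k kfg.
  by rewrite -![(_ - _) _]/(_ _ - (_ + _)) /= kfg (nbhs_singleton fg).
have dgf := diff_unique dfc gE.
by apply/diff_locallyP; split; rewrite dgf.
Qed.

Section ChartCalculus.
Context (R : realType) (n : nat) (M : charted_space R n) (a : chart M).
Hypothesis aopen : open (image_dom a).
Hypothesis aK : forall p, dom M a p -> param M a (Defs.coord M a p) = p.
Implicit Types (h k : M -> R) (p q : M).

Definition diff_at h p := differentiable (h \o param M a) (Defs.coord M a p).

(** A regularity weaker than smoothness that suffices to differentiate Christoffel symbols once and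
    to exchange second partials, and that passes easily through products, logarithms and coordinate
    projections. *)
Definition twice_diff h := forall p, dom M a p ->
  diff_at h p /\ forall i, diff_at (pd a i h) p.

(** Since the image of the chart is open, identities that hold on [dom M a] become identities near a
    point of the coordinate space, which is what derivatives require. *)
Lemma near_dom p : dom M a p ->
  \forall x \near Defs.coord M a p, dom M a (param M a x) /\ Defs.coord M a (param M a x) = x.
Proof.
move=> ap; have : image_dom a (Defs.coord M a p) by exists p.
move=> ip; have := open_nbhs_nbhs (conj aopen ip).
by apply: filterS => _ [q aq <-]; rewrite aK.
Qed.

Lemma near_chart h k p : (forall q, dom M a q -> h q = k q) -> dom M a p ->
  {near Defs.coord M a p, h \o param M a =1 k \o param M a}.
Proof.
move=> hk ap; have := near_dom ap; apply: filterS => x [ax _] /=; exact: hk.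
Qed.

Lemma diff_at_congr h k p : (forall q, dom M a q -> h q = k q) -> dom M a p ->
  diff_at h p -> diff_at k p.
Proof. by move=> hk ap; apply: near_eq_differentiable; exact: near_chart. Qed.

Lemma pd_congr h k i p : (forall q, dom M a q -> h q = k q) -> dom M a p ->
  pd a i h p = pd a i k p.
Proof. by move=> hk ap; apply: near_eq_derive; exact: near_chart. Qed.

(** [pd] evaluates the derivative at [coord] of a point, so composing it with [param] returns to [x]
    only where the two maps are mutually inverse, that is, near the image of [p]. *)
Lemma near_pd h i p : dom M a p ->
  {near Defs.coord M a p, 'D_(delta_mx 0 i : 'rV[R]_n) (h \o param M a)
                     =1 pd a i h \o param M a}.
Proof.
by move=> ap; have := near_dom ap; apply: filterS => x [_ xE]; rewrite /= /pd xE.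
Qed.

Lemma pd_cst c i p : pd a i (fun=> c) p = 0.
Proof. exact: derive_cst. Qed.

Lemma diff_at_cst c p : diff_at (fun=> c) p.
Proof. exact: differentiable_cst. Qed.

Lemma pdD h k i p : diff_at h p -> diff_at k p ->
  pd a i (fun q => h q + k q) p = pd a i h p + pd a i k p.
Proof. by move=> dh dk; rewrite /pd -deriveD //; exact: diff_derivable. Qed.

Lemma diff_atD h k p : diff_at h p -> diff_at k p ->
  diff_at (fun q => h q + k q) p.
Proof. by move=> dh dk; exact: differentiableD. Qed.

Lemma diff_atN h p : diff_at h p -> diff_at (fun q => - h q) p.
Proof. by move=> dh; exact: differentiableN. Qed.

Lemma pdN h i p : diff_at h p -> pd a i (fun q => - h q) p = - pd a i h p.
Proof. by move=> dh; rewrite /pd -deriveN //; exact: diff_derivable. Qed.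

Lemma pdM h k i p : dom M a p -> diff_at h p -> diff_at k p ->
  pd a i (fun q => h q * k q) p = pd a i h p * k p + h p * pd a i k p.
Proof.
move=> ap dh dk; rewrite /pd.
have /= := deriveM (diff_derivable (v := delta_mx 0 i) dh) (diff_derivable dk).
by rewrite aK // => ->; rewrite addrC mulrC.
Qed.

Lemma pdZ c h i p : diff_at h p ->
  pd a i (fun q => c * h q) p = c * pd a i h p.
Proof. by move=> dh; apply: (deriveZ c); exact: diff_derivable. Qed.

Lemma diff_atM h k p : diff_at h p -> diff_at k p ->
  diff_at (fun q => h q * k q) p.
Proof. by move=> dh dk; exact: differentiableM. Qed.

Lemma diff_atV h p : dom M a p -> h p != 0 -> diff_at h p ->
  diff_at (fun q => (h q)^-1) p.
Proof. by move=> ap hp dh; apply: differentiableV => //=; rewrite aK. Qed.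

Lemma diff_at_sum (I : Type) (r : seq I) (F : I -> M -> R) p :
  (forall i, diff_at (F i) p) -> diff_at (fun q => \sum_(i <- r) F i q) p.
Proof.
move=> dF; elim: r => [|i r IH].
  rewrite (_ : (fun q => _) = fun=> 0); first exact: diff_at_cst.
  by apply/funext => q; rewrite big_nil.
rewrite (_ : (fun q => _) = fun q => F i q + \sum_(j <- r) F j q).
  exact: diff_atD.
by apply/funext => q; rewrite big_cons.
Qed.

Lemma pd_sum (I : Type) (r : seq I) (F : I -> M -> R) j p :
  (forall i, diff_at (F i) p) ->
  pd a j (fun q => \sum_(i <- r) F i q) p = \sum_(i <- r) pd a j (F i) p.
Proof.
move=> dF; elim: r => [|i r IH].
  rewrite big_nil (_ : (fun q => _) = fun=> 0) ?pd_cst //.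
  by apply/funext => q; rewrite big_nil.
rewrite big_cons -IH -pdD //; last exact: diff_at_sum.
by congr pd; apply/funext => q; rewrite big_cons.
Qed.

Lemma diff_at_prod (I : Type) (r : seq I) (F : I -> M -> R) p :
  (forall i, diff_at (F i) p) -> diff_at (fun q => \prod_(i <- r) F i q) p.
Proof.
move=> dF; elim: r => [|i r IH].
  rewrite (_ : (fun q => _) = fun=> 1); first exact: diff_at_cst.
  by apply/funext => q; rewrite big_nil.
rewrite (_ : (fun q => _) = fun q => F i q * \prod_(j <- r) F j q).
  exact: diff_atM.
by apply/funext => q; rewrite big_cons.
Qed.

Lemma diff_at_det m (G : M -> 'M[R]_m) p :
  (forall i j, diff_at (fun q => G q i j) p) -> diff_at (fun q => \det (G q)) p.
Proof.
move=> dG; apply: diff_at_sum => s; apply: diff_atM; first exact: diff_at_cst.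
exact: diff_at_prod.
Qed.

(** Cramer's rule writes each entry as a cofactor over the determinant. The formula agrees with
    [invmx] on invertible matrices, hence on the domain of the chart. *)
Lemma diff_at_invmx m (G : M -> 'M[R]_m) p : dom M a p ->
  (forall q, dom M a q -> G q \in unitmx) ->
  (forall i j, diff_at (fun q => G q i j) p) ->
  forall i j, diff_at (fun q => invmx (G q) i j) p.
Proof.
move=> ap Gu dG i j.
apply: (@diff_at_congr (fun q => (\det (G q))^-1 * cofactor (G q) j i)) => //.
  by move=> q aq; rewrite /invmx Gu // !mxE.
apply: diff_atM.
  apply: diff_atV => //; last exact: diff_at_det.
  by have := Gu p ap; rewrite unitmxE unitfE.
apply: diff_atM; first exact: diff_at_cst.
apply: diff_at_det => k l.
by rewrite (_ : (fun q => _) = fun q => G q (lift j k) (lift i l)) //;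
  apply/funext => q; rewrite !mxE.
Qed.

Lemma pd_comm h i j p : twice_diff h -> dom M a p ->
  pd a i (pd a j h) p = pd a j (pd a i h) p.
Proof.
move=> dh ap; have [_ dhp] := dh p ap.
rewrite /pd -(near_eq_derive _ (near_pd h j ap)) -(near_eq_derive _ (near_pd h i ap)).
apply: derive_comm.
- have := near_dom ap; apply: filterS => x [ax xE].
  by have [] := dh _ ax; rewrite /diff_at xE.
- apply: near_eq_differentiable (dhp j).
  by have := near_pd h j ap; apply: filterS => x ->.
- apply: near_eq_differentiable (dhp i).
  by have := near_pd h i ap; apply: filterS => x ->.
Qed.

Lemma twice_diffM h k : twice_diff h -> twice_diff k ->
  twice_diff (fun q => h q * k q).
Proof.
move=> dh dk p ap; have [h0 h1] := dh p ap; have [k0 k1] := dk p ap.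
split=> [|i]; first exact: diff_atM.
apply: (@diff_at_congr (fun q => pd a i h q * k q + h q * pd a i k q)) => //.
  by move=> q aq; exact: esym (pdM i aq (dh q aq).1 (dk q aq).1).
by apply: diff_atD; apply: diff_atM.
Qed.

Lemma smooth_twice_diff h : smooth_on (image_dom a) (h \o param M a) ->
  twice_diff h.
Proof.
move=> sh p ap; have ip : image_dom a (Defs.coord M a p) by exists p.
split=> [|i]; first exact: (sh [::]).
exact: near_eq_differentiable (near_pd h i ap) (sh [:: i] _ ip).
Qed.

Lemma differentiable_ln (x : R) : 0 < x -> differentiable (@ln R) x.
Proof. by move=> x0; apply/derivable1_diffP; have [] := is_derive1_ln x0. Qed.

Lemma diff_at_ln h p : dom M a p -> 0 < h p -> diff_at h p ->
  diff_at (fun q => ln (h q)) p.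
Proof.
move=> ap hp dh; apply: differentiable_comp dh _.
by rewrite /= aK //; exact: differentiable_ln.
Qed.

Lemma pd_ln h i p : dom M a p -> 0 < h p -> diff_at h p ->
  pd a i (fun q => ln (h q)) p = (h p)^-1 * pd a i h p.
Proof.
move=> ap hp dh; have dlh := diff_at_ln ap hp dh.
have dln : differentiable (@ln R) ((h \o param M a) (Defs.coord M a p)).
  by rewrite /= aK //; exact: differentiable_ln.
rewrite /pd (deriveE _ dlh) (deriveE _ dh).
rewrite (diff_comp (f := h \o param M a) (g := @ln R)) //=.
have lnE : 'd (@ln R) (h p) 1 = (h p)^-1.
  by rewrite -deriveE; [have [_ ->] := is_derive1_ln hp|exact: differentiable_ln].
by rewrite aK // -[X in 'd _ _ X]mulr1 [LHS]linearZ /= lnE mulrC.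
Qed.

Lemma twice_diff_ln h : (forall q, 0 < h q) -> twice_diff h ->
  twice_diff (fun q => ln (h q)).
Proof.
move=> h0 dh p ap; have [d0 d1] := dh p ap; split=> [|i].
  exact: diff_at_ln.
apply: (@diff_at_congr (fun q => (h q)^-1 * pd a i h q)) => //.
  by move=> q aq; rewrite pd_ln //; case: (dh q aq).
by apply: diff_atM => //; apply: diff_atV => //; rewrite gt_eqF.
Qed.

End ChartCalculus.

(** * Index algebra of the conformal change *)

(** Often used from right to left: a lone term becomes a sum, and an identity between sums can then
    be checked summand by summand. *)
Lemma sum_delta (R : pzRingType) n (k : 'I_n) (F : 'I_n -> R) :
  \sum_(m < n) (m == k)%:R * F m = F k.
Proof.
rewrite (bigD1 k) //= eqxx mul1r big1 ?addr0 // => m /negbTE ->.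
by rewrite mul0r.
Qed.

(* The difference between the Christoffel symbols of e^(2 sigma) g and of g,
   with s = d sigma and s' = grad sigma. *)
Definition conformal_shift (R : pzRingType) n (G : 'I_n -> 'I_n -> R)
    (s s' : 'I_n -> R) (k i j : 'I_n) : R :=
  (k == j)%:R * s i + (k == i)%:R * s j - G i j * s' k.

Section ConformalAlgebra.
Context (R : numFieldType) (n : nat).
Implicit Types (i j k l m : 'I_n).
Variables (G H : 'I_n -> 'I_n -> R) (Gam : 'I_n -> 'I_n -> 'I_n -> R).
Variables (s s' : 'I_n -> R).
Hypothesis G_sym : forall i j, G i j = G j i.
Hypothesis Gam_sym : forall k i j, Gam k i j = Gam k j i.
Hypothesis lower : forall j, \sum_(m < n) G j m * s' m = s j.

Local Notation S := (conformal_shift G s s').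

Let lowerr k : \sum_(i < n) s' i * G i k = s k.
Proof. by rewrite -lower; apply: eq_bigr => i _; rewrite mulrC G_sym. Qed.

Lemma conformal_shift_contract_up (F : 'I_n -> R) j k :
  \sum_(m < n) F m * S m j k
  = F k * s j + F j * s k - G j k * \sum_(m < n) F m * s' m.
Proof.
rewrite -(sum_delta k (fun m => F m * s j)) -(sum_delta j (fun m => F m * s k)).
rewrite mulr_sumr -!big_split /= -sumrB; apply: eq_bigr => m _.
by rewrite /conformal_shift; ring.
Qed.

(** [Y] is left free because it is taken to be [Gam] for a mixed term of the curvature and the shift
    itself for the quadratic one. *)
Lemma conformal_shift_contract_low (Y : 'I_n -> 'I_n -> R) j :
  \sum_(i < n) \sum_(m < n) S i j m * Y m i
  = s j * \sum_(m < n) Y m m + \sum_(m < n) s m * Y m j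
    - \sum_(i < n) s' i * \sum_(m < n) G j m * Y m i.
Proof.
have -> : \sum_(m < n) s m * Y m j = \sum_(i < n) (i == j)%:R * \sum_(m < n) s m * Y m i.
  by rewrite sum_delta.
rewrite mulr_sumr -big_split /= -sumrB; apply: eq_bigr => i _.
rewrite -(sum_delta i (fun m => s j * Y m i)) !mulr_sumr -big_split /= -sumrB.
by apply: eq_bigr => m _; rewrite /conformal_shift (eq_sym i m); ring.
Qed.

(** The Kronecker term and the metric term both contract to [s m] and cancel, which leaves the trace
    of the identity times [s m]. *)
Lemma conformal_shift_trace m : \sum_(i < n) S i i m = n%:R * s m.
Proof.
under eq_bigr => i _ do rewrite /conformal_shift eqxx mul1r [G i m * _]mulrC.
rewrite sumrB lowerr big_split /= sum_delta sumr_const card_ord.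
by rewrite addrAC subrr add0r mulr_natl.
Qed.

(** The products expand into the [Gam] part and the six sums [A1] to [B3]. The traces in [A2] and
    [A3] supply [n], and the other sums correct it to [n - 2]. The last sum keeps its form because
    metric compatibility turns it into the derivative of the metric along [s']. *)
Lemma conformal_shift_quadratic j k :
  \sum_(i < n) \sum_(m < n)
    ((Gam i i m + S i i m) * (Gam m j k + S m j k)
     - (Gam i j m + S i j m) * (Gam m i k + S m i k))
  = \sum_(i < n) \sum_(m < n) (Gam i i m * Gam m j k - Gam i j m * Gam m i k)
    + (n%:R - 2) * (\sum_(m < n) Gam m j k * s m + s j * s k
                    - G j k * \sum_(m < n) s m * s' m)
    - G j k * \sum_(i < n) \sum_(m < n) Gam i i m * s' m
    + \sum_(i < n) s' i * \sum_(m < n) (Gam m i j * G m k + Gam m i k * G j m).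
Proof.
set N := \sum_(m < n) s m * s' m; set L := \sum_(m < n) Gam m j k * s m.
set W := \sum_(i < n) \sum_(m < n) Gam i i m * s' m.
(* [T] is the contracted symbol, which cancels between [A1] and [B1], [B2]; [X1] and [X2] are the
   two halves of the compatibility expression. *)
pose T k := \sum_(i < n) Gam i i k.
pose X1 := \sum_(i < n) G i k * \sum_(m < n) Gam i j m * s' m.
pose X2 := \sum_(i < n) s' i * \sum_(m < n) G j m * Gam m i k.
have sS : \sum_(m < n) s m * S m j k = s k * s j + s j * s k - G j k * N.
  exact: conformal_shift_contract_up.
have A1 : \sum_(i < n) \sum_(m < n) Gam i i m * S m j k
    = T k * s j + T j * s k - G j k * W.
  under eq_bigr => i _ do rewrite conformal_shift_contract_up.
  by rewrite sumrB big_split /= -!mulr_suml -mulr_sumr.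
have A2 : \sum_(i < n) \sum_(m < n) S i i m * Gam m j k = n%:R * L.
  rewrite exchange_big /= mulr_sumr; apply: eq_bigr => m _.
  by rewrite -mulr_suml conformal_shift_trace mulrAC mulrA.
have A3 : \sum_(i < n) \sum_(m < n) S i i m * S m j k
    = n%:R * (s k * s j + s j * s k - G j k * N).
  rewrite -sS exchange_big /= mulr_sumr; apply: eq_bigr => m _.
  by rewrite -mulr_suml conformal_shift_trace mulrA.
have B1 : \sum_(i < n) \sum_(m < n) Gam i j m * S m i k = L + T j * s k - X1.
  under eq_bigr => i _ do rewrite conformal_shift_contract_up (Gam_sym i j i).
  by rewrite sumrB big_split /= -!mulr_suml.
have B2 : \sum_(i < n) \sum_(m < n) S i j m * Gam m i k = s j * T k + L - X2.
  rewrite (conformal_shift_contract_low (fun m i => Gam m i k)).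
  by congr (_ + _ - _); apply: eq_bigr => m _; rewrite mulrC.
have B3 : \sum_(i < n) \sum_(m < n) S i j m * S m i k
    = n%:R * s j * s k + 2 * s j * s k - 2 * G j k * N.
  rewrite (conformal_shift_contract_low (fun m i => S m i k)).
  rewrite conformal_shift_trace sS.
  under [X in _ - X]eq_bigr => i _ do
    rewrite conformal_shift_contract_up lower mulrBr mulrDr !mulrA
      [s' i * G j k]mulrC -[G j k * _ * _]mulrA [s' i * s i]mulrC [s' i * G j i]mulrC.
  rewrite sumrB big_split /= -!mulr_suml -mulr_sumr lowerr lower -/N.
  by ring.
have D : \sum_(i < n) s' i * \sum_(m < n) (Gam m i j * G m k + Gam m i k * G j m)
    = X1 + X2.
  under eq_bigr => i _ do rewrite big_split mulrDr.
  rewrite big_split /=; congr (_ + _); last first.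
    by apply: eq_bigr => i _; congr (_ * _); apply: eq_bigr => m _; rewrite mulrC.
  rewrite /X1; under eq_bigr do rewrite mulr_sumr.
  rewrite exchange_big /=; apply: eq_bigr => i _; rewrite mulr_sumr.
  by apply: eq_bigr => m _; rewrite (Gam_sym i m j); ring.
rewrite D; transitivity (\sum_(i < n) \sum_(m < n) (Gam i i m * Gam m j k - Gam i j m * Gam m i k)
  + (n%:R * L + (T k * s j + T j * s k - G j k * W)
     + n%:R * (s k * s j + s j * s k - G j k * N))
  - ((L + T j * s k - X1) + (s j * T k + L - X2)
     + (n%:R * s j * s k + 2 * s j * s k - 2 * G j k * N))); last by ring.
rewrite -A1 -A2 -A3 -B1 -B2 -B3 -!big_split /= -sumrB; apply: eq_bigr => i _.
rewrite -!big_split /= -sumrB; apply: eq_bigr => m _; ring.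
Qed.

Hypothesis HG : forall i k, \sum_(l < n) H i l * G l k = (i == k)%:R.

(** The trace of the Hessian is the divergence of the gradient. Here [dG], [ds] and [ds'] stand for
    the partial derivatives of [G], [s] and [s']; the first hypothesis is compatibility of [Gam]
    with [G], the second the product rule for [lower]. *)
Lemma laplacian_divergence (ds ds' : 'I_n -> 'I_n -> R)
    (dG : 'I_n -> 'I_n -> 'I_n -> R) :
  (forall i j k, \sum_(m < n) (Gam m i j * G m k + Gam m i k * G j m) = dG i j k) ->
  (forall i l, \sum_(k < n) (dG i l k * s' k + G l k * ds' i k) = ds i l) ->
  \sum_(i < n) \sum_(l < n) H i l * (ds i l - \sum_(m < n) Gam m i l * s m)
  = \sum_(i < n) ds' i i + \sum_(i < n) \sum_(m < n) Gam i i m * s' m.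
Proof.
move=> dGE dsE; rewrite -big_split /=; apply: eq_bigr => i _.
(* [V] is the covariant derivative of [s'] in direction [i]; compatibility says that lowering its
   index gives the covariant derivative of [s], and [H] then undoes the lowering. *)
pose V m := ds' i m + \sum_(k < n) Gam m i k * s' k.
have E l : ds i l - \sum_(m < n) Gam m i l * s m = \sum_(m < n) G l m * V m.
  rewrite -dsE big_split /= /V.
  under [RHS]eq_bigr => m _ do rewrite mulrDr.
  rewrite big_split /= [LHS]addrAC addrC; congr (_ + _).
  under eq_bigr => k _ do rewrite -dGE big_split mulrDl.
  rewrite big_split /= (_ : \sum_(m < n) Gam m i l * s m
    = \sum_(k < n) (\sum_(m < n) Gam m i l * G m k) * s' k).
    rewrite addrC addKr; under eq_bigr do rewrite mulr_suml.
    rewrite exchange_big /=; apply: eq_bigr => m _; rewrite mulr_sumr.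
    by apply: eq_bigr => k _; ring.
  under [RHS]eq_bigr do rewrite mulr_suml.
  rewrite exchange_big /=; apply: eq_bigr => m _; rewrite -lower mulr_sumr.
  by apply: eq_bigr => k _; rewrite mulrA.
under eq_bigr => l _ do rewrite E mulr_sumr.
rewrite exchange_big /= -/(V i) -(sum_delta i V); apply: eq_bigr => m _.
by rewrite eq_sym -HG mulr_suml; apply: eq_bigr => l _; rewrite mulrA.
Qed.

(** Lowering the upper index gives the Christoffel symbols of the first kind ([low]). In the sum of
    the two with [j] and [k] exchanged, all derivatives but [dG i j k] cancel. *)
Lemma levi_civita_metric (dG : 'I_n -> 'I_n -> 'I_n -> R) :
  (forall i j k, dG i j k = dG i k j) ->
  (forall i k, \sum_(l < n) G i l * H l k = (i == k)%:R) ->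
  (forall k i j, Gam k i j
     = 2^-1 * \sum_(l < n) H k l * (dG i j l + dG j i l - dG l i j)) ->
  forall i j k, \sum_(m < n) (Gam m i j * G m k + Gam m i k * G j m) = dG i j k.
Proof.
move=> dG_sym GH GamE i j k.
have low c a b : \sum_(m < n) G c m * Gam m a b
    = 2^-1 * (dG a b c + dG b a c - dG c a b).
  rewrite -(sum_delta c (fun l => dG a b l + dG b a l - dG l a b)) mulr_sumr.
  under eq_bigr => m _ do rewrite GamE mulrCA mulr_sumr.
  rewrite -!mulr_sumr exchange_big; congr (_ * _); apply: eq_bigr => l _.
  by rewrite eq_sym -GH mulr_suml; apply: eq_bigr => m _; rewrite mulrA.
rewrite big_split /=; under eq_bigr => m _ do rewrite mulrC G_sym.
rewrite low; under eq_bigr => m _ do rewrite mulrC.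
by rewrite low (dG_sym i k j); field.
Qed.

End ConformalAlgebra.

(** * Conformal change of the Ricci tensor and of the Hessian *)

Section ConformalMetric.
Context (R : realType) (n : nat) (M : charted_space R n) (a : chart M).
Hypothesis aopen : open (image_dom a).
Hypothesis aK : forall p, dom M a p -> param M a (Defs.coord M a p) = p.
Variables (g : tensor2 M) (phi : M -> R).
Hypothesis g_sym : forall p, dom M a p -> (g a p)^T = g a p.
Hypothesis g_unit : forall p, dom M a p -> g a p \in unitmx.
Hypothesis g_smooth : forall i j, twice_diff a (fun q => g a q i j).
Hypothesis phi_gt0 : forall p, 0 < phi p.
Hypothesis phi_smooth : twice_diff a phi.
Implicit Types (p q : M) (i j k l m : 'I_n).

Let sigma p := ln (phi p).
Let gL := scale_metric phi g.

Lemma metric_symE p i j : dom M a p -> g a p i j = g a p j i.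
Proof. by move=> ap; rewrite -{1}(g_sym ap) mxE. Qed.

Lemma metric_inv p i k : dom M a p ->
  \sum_(l < n) g a p i l * invmx (g a p) l k = (i == k)%:R.
Proof. by move=> ap; have := mulmxV (g_unit ap) => /matrixP/(_ i k); rewrite !mxE. Qed.

Lemma inv_metric p i k : dom M a p ->
  \sum_(l < n) invmx (g a p) i l * g a p l k = (i == k)%:R.
Proof. by move=> ap; have := mulVmx (g_unit ap) => /matrixP/(_ i k); rewrite !mxE. Qed.

Lemma pd_metric_sym p i j k : dom M a p ->
  pd a i (fun q => g a q j k) p = pd a i (fun q => g a q k j) p.
Proof. by move=> ap; apply: (pd_congr aopen aK) => // q; exact: metric_symE. Qed.

Lemma christoffel_sym p k i j : dom M a p ->
  christoffel g a k i j p = christoffel g a k j i p.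
Proof.
move=> ap; rewrite /christoffel; congr (_ * _); apply: eq_bigr => l _.
by rewrite (pd_metric_sym l j i ap) [_ + pd a j _ _]addrC.
Qed.

Lemma gradient_lower (u : M -> R) p j : dom M a p ->
  \sum_(m < n) g a p j m * gradient g u a p 0 m = pd a j u p.
Proof.
move=> ap; rewrite -(sum_delta j (fun l => pd a l u p)).
under eq_bigr => m _ do rewrite mxE mulr_sumr.
rewrite exchange_big /=; apply: eq_bigr => l _.
by rewrite eq_sym -(metric_inv _ _ ap) mulr_suml; apply: eq_bigr => m _; rewrite mulrA.
Qed.

Lemma inner_gradient (u v : M -> R) p : dom M a p ->
  inner g (gradient g u) (gradient g v) a p
  = \sum_(k < n) pd a k u p * gradient g v a p 0 k.
Proof.
move=> ap; rewrite /inner exchange_big /=; apply: eq_bigr => k _.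
rewrite -gradient_lower // mulr_suml; apply: eq_bigr => m _.
by rewrite (metric_symE m k ap).
Qed.

Lemma diff_at_metric p i j : dom M a p -> diff_at a (fun q => g a q i j) p.
Proof. by move=> ap; have [] := g_smooth i j ap. Qed.

Lemma diff_at_pd_metric p k i j : dom M a p ->
  diff_at a (pd a k (fun q => g a q i j)) p.
Proof. by move=> ap; have [] := g_smooth i j ap. Qed.

Lemma diff_at_inv_metric p i j : dom M a p ->
  diff_at a (fun q => invmx (g a q) i j) p.
Proof.
by move=> ap; apply: diff_at_invmx => // k l; exact: diff_at_metric.
Qed.

Lemma diff_at_christoffel p k i j : dom M a p ->
  diff_at a (christoffel g a k i j) p.
Proof.
move=> ap; apply: diff_atM; first exact: diff_at_cst.
apply: diff_at_sum => l; apply: diff_atM; first exact: diff_at_inv_metric.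
apply: diff_atD; first by apply: diff_atD; exact: diff_at_pd_metric.
by apply: diff_atN; exact: diff_at_pd_metric.
Qed.

Lemma sigma_smooth : twice_diff a sigma.
Proof. exact: twice_diff_ln. Qed.

Lemma diff_at_gradient p k : dom M a p ->
  diff_at a (fun q => gradient g sigma a q 0 k) p.
Proof.
move=> ap; rewrite (_ : (fun q => _) = fun q =>
  \sum_(l < n) invmx (g a q) k l * pd a l sigma q); last first.
  by apply/funext => q; rewrite mxE.
apply: diff_at_sum => l; apply: diff_atM; first exact: diff_at_inv_metric.
by have [] := sigma_smooth ap.
Qed.

Let shift q := conformal_shift (g a q) (fun i => pd a i sigma q)
  (fun k => gradient g sigma a q 0 k).

(** As [d phi = phi * d sigma], the factor [phi ^+ 2] can be pulled out whole; it later cancels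
    against the inverse of [gL]. *)
Lemma pd_scale_metric p i j l : dom M a p ->
  pd a i (fun q => gL a q j l) p
  = phi p ^+ 2 * (2 * pd a i sigma p * g a p j l + pd a i (fun q => g a q j l) p).
Proof.
move=> ap; have [dphi _] := phi_smooth ap; have dg := diff_at_metric j l ap.
have -> : (fun q => gL a q j l) = fun q => (phi q * phi q) * g a q j l.
  by apply/funext => q; rewrite mxE.
have pd_phi : pd a i phi p = phi p * pd a i sigma p.
  by rewrite (pd_ln aK i ap (phi_gt0 p) dphi) mulVKf // gt_eqF.
transitivity (pd a i (fun q => phi q * phi q) p * g a p j l
  + phi p * phi p * pd a i (fun q => g a q j l) p).
  exact: pdM (diff_atM dphi dphi) dg.
have -> : pd a i (fun q => phi q * phi q) p
  = phi p * pd a i sigma p * phi p + phi p * (phi p * pd a i sigma p).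
  by rewrite -pd_phi; exact: pdM.
by move: (pd a i sigma p) (pd a i _ p) (phi p) (g a p j l) => *; ring.
Qed.

Lemma christoffel_conformal p k i j : dom M a p ->
  christoffel gL a k i j p = christoffel g a k i j p + shift p k i j.
Proof.
move=> ap; rewrite /christoffel /shift /conformal_shift mxE.
have phi2 : phi p ^+ 2 != 0 by rewrite expf_neq0 // gt_eqF.
under eq_bigr => l _ do rewrite !pd_scale_metric //.
(* The Kronecker deltas of the shift are written back as sums of inverse metric times metric, so
   that both sides are sums over the same [l]. *)
rewrite -(inv_metric k j ap) -(inv_metric k i ap) !mulr_suml !mulr_sumr.
rewrite -sumrN -!big_split /=; apply: eq_bigr => l _.
rewrite /gL /scale_metric invmxZ; last by rewrite unitmxZ ?unitfE // g_unit.
rewrite mxE (metric_symE l j ap) (metric_symE l i ap).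
move: (phi p) (invmx _ k l) (g a p j l) (g a p i l) (g a p i j) phi2 => f H G1 G2 G3.
move: (pd a _ _ p) (pd a _ _ p) (pd a _ _ p) (pd a _ _ p) (pd a _ _ p) (pd a _ _ p).
by move=> *; field; rewrite -sqrf_eq0.
Qed.

Lemma pd_shift p l k i j : dom M a p ->
  pd a l (fun q => shift q k i j) p
  = (k == j)%:R * pd a l (pd a i sigma) p + (k == i)%:R * pd a l (pd a j sigma) p
    - (pd a l (fun q => g a q i j) p * gradient g sigma a p 0 k
       + g a p i j * pd a l (fun q => gradient g sigma a q 0 k) p)
  /\ diff_at a (fun q => shift q k i j) p.
Proof.
move=> ap; rewrite /shift /conformal_shift.
have ds m : diff_at a (pd a m sigma) p by have [] := sigma_smooth ap.
have dc c m : diff_at a (fun q => c * pd a m sigma q) p.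
  by apply: diff_atM => //; exact: diff_at_cst.
have dg := diff_at_metric i j ap; have dv := diff_at_gradient k ap.
have dgv := diff_atM dg dv.
split; last by apply: diff_atD; [exact: diff_atD|exact: diff_atN].
transitivity (pd a l (fun q => (k == j)%:R * pd a i sigma q) p
    + pd a l (fun q => (k == i)%:R * pd a j sigma q) p
    - pd a l (fun q => g a q i j * gradient g sigma a q 0 k) p).
  rewrite (pdD l (diff_atD (dc _ _) (dc _ _)) (diff_atN dgv)) (pdN l dgv).
  by rewrite (pdD l (dc _ _) (dc _ _)).
by congr (_ + _ - _); [exact: pdZ|exact: pdZ|exact: pdM].
Qed.

Lemma pd_christoffel_conformal p l k i j : dom M a p ->
  pd a l (christoffel gL a k i j) p
  = pd a l (christoffel g a k i j) p + pd a l (fun q => shift q k i j) p.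
Proof.
move=> ap; rewrite -(pdD l (diff_at_christoffel k i j ap) (pd_shift l k i j ap).2).
by apply: (pd_congr aopen aK) => // q; exact: christoffel_conformal.
Qed.

(** Product rule for [gradient_lower]: the second hypothesis of [laplacian_divergence], needed again
    for the trace of the differentiated shift. *)
Lemma pd_gradient_lower p l k : dom M a p ->
  \sum_(i < n) (pd a l (fun q => g a q k i) p * gradient g sigma a p 0 i
    + g a p k i * pd a l (fun q => gradient g sigma a q 0 i) p)
  = pd a l (pd a k sigma) p.
Proof.
move=> ap; have dgv i := diff_atM (diff_at_metric k i ap) (diff_at_gradient i ap).
transitivity (pd a l (fun q => \sum_(i < n) g a q k i * gradient g sigma a q 0 i) p).
  rewrite (pd_sum _ _ dgv); apply: eq_bigr => i _.
  exact: esym (pdM aK l ap (diff_at_metric k i ap) (diff_at_gradient i ap)).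
by apply: (pd_congr aopen aK) => // q; exact: gradient_lower.
Qed.

(** This is the vanishing of the covariant derivative of [g], in coordinates. *)
Lemma christoffel_metric p i j k : dom M a p ->
  \sum_(m < n) (christoffel g a m i j p * g a p m k
                + christoffel g a m i k p * g a p j m)
  = pd a i (fun q => g a q j k) p.
Proof.
move=> ap.
apply: (@levi_civita_metric _ _ (g a p) (invmx (g a p))
  (fun k i j => christoffel g a k i j p) _ (fun i j k => pd a i (fun q => g a q j k) p)).
- by move=> *; exact: metric_symE.
- by move=> *; exact: pd_metric_sym.
- by move=> *; exact: metric_inv.
- by [].
Qed.

Lemma laplacian_sigma p : dom M a p ->
  laplacian g sigma a p
  = \sum_(i < n) pd a i (fun q => gradient g sigma a q 0 i) p
    + \sum_(i < n) \sum_(m < n) christoffel g a i i m p * gradient g sigma a p 0 m.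
Proof.
move=> ap; rewrite /laplacian /metric_trace.
under eq_bigr => i _ do under eq_bigr => j _ do rewrite mxE.
apply: (@laplacian_divergence _ _ (g a p) (invmx (g a p))
  (fun k i j => christoffel g a k i j p) (fun i => pd a i sigma p)
  (fun k => gradient g sigma a p 0 k) _ _ (fun i l => pd a i (pd a l sigma) p)
  (fun i k => pd a i (fun q => gradient g sigma a q 0 k) p)
  (fun i j k => pd a i (fun q => g a q j k) p)).
- by move=> *; exact: gradient_lower.
- by move=> *; exact: inv_metric.
- by move=> *; exact: christoffel_metric.
- by move=> *; exact: pd_gradient_lower.
Qed.

(** The sum with derivatives of [g] along the gradient is the one that
    [christoffel_quadratic_conformal] cancels in the Ricci tensor. *)
Lemma sum_pd_christoffel_conformal p j k : dom M a p ->
  \sum_(i < n) pd a i (christoffel gL a i j k) p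
  = \sum_(i < n) pd a i (christoffel g a i j k) p
    + pd a k (pd a j sigma) p + pd a j (pd a k sigma) p
    - \sum_(i < n) gradient g sigma a p 0 i * pd a i (fun q => g a q j k) p
    - g a p j k * \sum_(i < n) pd a i (fun q => gradient g sigma a q 0 i) p.
Proof.
move=> ap; rewrite -(sum_delta k (fun i => pd a i (pd a j sigma) p)).
rewrite -(sum_delta j (fun i => pd a i (pd a k sigma) p)) mulr_sumr.
rewrite -!big_split -!sumrB /=; apply: eq_bigr => i _.
rewrite pd_christoffel_conformal // (pd_shift i i j k ap).1.
by rewrite opprD [pd a i _ p * gradient _ _ _ _ _ _]mulrC !addrA.
Qed.

(** Differentiated form of [conformal_shift_trace]: the metric part is again the derivative of
    [d sigma] and cancels the Kronecker part. *)
Lemma pd_christoffel_trace_conformal p j k : dom M a p ->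
  \sum_(i < n) pd a j (christoffel gL a i i k) p
  = \sum_(i < n) pd a j (christoffel g a i i k) p + n%:R * pd a j (pd a k sigma) p.
Proof.
move=> ap; transitivity (\sum_(i < n) (pd a j (christoffel g a i i k) p
    + ((i == k)%:R * pd a j (pd a i sigma) p + pd a j (pd a k sigma) p
       - (pd a j (fun q => g a q k i) p * gradient g sigma a p 0 i
          + g a p k i * pd a j (fun q => gradient g sigma a q 0 i) p)))).
  apply: eq_bigr => i _.
  rewrite pd_christoffel_conformal // (pd_shift j i i k ap).1 eqxx mul1r.
  by rewrite (metric_symE i k ap) (pd_metric_sym j i k ap).
rewrite big_split /= sumrB pd_gradient_lower // big_split /= sum_delta.
by rewrite sumr_const card_ord addrAC subrr add0r mulr_natl.
Qed.

Lemma ricciE (h : tensor2 M) p j k : ricci h a p j k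
  = \sum_(i < n) pd a i (christoffel h a i j k) p
    - \sum_(i < n) pd a j (christoffel h a i i k) p
    + \sum_(i < n) \sum_(m < n)
        (christoffel h a i i m p * christoffel h a m j k p
         - christoffel h a i j m p * christoffel h a m i k p).
Proof. by rewrite mxE big_split sumrB. Qed.

Lemma christoffel_quadratic_conformal p j k : dom M a p ->
  \sum_(i < n) \sum_(m < n)
    (christoffel gL a i i m p * christoffel gL a m j k p
     - christoffel gL a i j m p * christoffel gL a m i k p)
  = \sum_(i < n) \sum_(m < n)
      (christoffel g a i i m p * christoffel g a m j k p
       - christoffel g a i j m p * christoffel g a m i k p)
    + (n%:R - 2) * (\sum_(m < n) christoffel g a m j k p * pd a m sigma p
                    + pd a j sigma p * pd a k sigma p
                    - g a p j k * \sum_(m < n) pd a m sigma p * gradient g sigma a p 0 m)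
    - g a p j k * \sum_(i < n) \sum_(m < n)
        christoffel g a i i m p * gradient g sigma a p 0 m
    + \sum_(i < n) gradient g sigma a p 0 i * pd a i (fun q => g a q j k) p.
Proof.
move=> ap; have := @conformal_shift_quadratic _ _ (g a p)
  (fun k i j => christoffel g a k i j p) (fun i => pd a i sigma p)
  (fun k => gradient g sigma a p 0 k) (fun i j => metric_symE i j ap)
  (fun k i j => christoffel_sym k i j ap) (fun j => gradient_lower sigma j ap) j k.
move=> quad; apply: etrans (etrans quad _).
  by apply: eq_bigr => i _; apply: eq_bigr => m _; rewrite !christoffel_conformal.
by congr (_ + _); apply: eq_bigr => i _; rewrite christoffel_metric.
Qed.

Lemma ricci_conformal p : dom M a p ->
  ricci gL a p = ricci g a p
    - (n%:R - 2) *: (hessian g sigma a p - otimes (diff1 sigma) (diff1 sigma) a p)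
    - (laplacian g sigma a p
       + (n%:R - 2) * inner g (gradient g sigma) (gradient g sigma) a p) *: g a p.
Proof.
move=> ap; apply/matrixP => j k; rewrite inner_gradient // laplacian_sigma //.
have subst3 (A B C A' B' C' : R) :
  A = A' -> B = B' -> C = C' -> A - B + C = A' - B' + C' by move=> -> -> ->.
rewrite ricciE (subst3 _ _ _ _ _ _ (sum_pd_christoffel_conformal j k ap)
  (pd_christoffel_trace_conformal j k ap) (christoffel_quadratic_conformal j k ap)).
rewrite 2!mxE ricciE !mxE (pd_comm aopen aK k j sigma_smooth ap).
(* Here [dd] is the second partial of [sigma], [L] its Christoffel correction, [N] the squared norm
   of the gradient and [D + W] the Laplacian; [X] cancels, and [2 - d] copies of [dd] join [L] to
   form the Hessian. *)
have ring_id (A B D L N Q W X dd sj sk gjk d : R) :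
    A + dd + dd - X - gjk * D - (B + d * dd)
      + (Q + (d - 2) * (L + sj * sk - gjk * N) - gjk * W + X)
    = A - B + Q - (d - 2) * (dd - L - sj * sk) - (D + W + (d - 2) * N) * gjk by ring.
exact: ring_id.
Qed.

(** Only the Christoffel term of the Hessian sees the metric, and contracting the shift with [du]
    produces the three corrections. *)
Lemma hessian_conformal (u : M -> R) p : dom M a p ->
  hessian gL u a p = hessian g u a p
    - otimes (diff1 u) (diff1 sigma) a p - otimes (diff1 sigma) (diff1 u) a p
    + inner g (gradient g u) (gradient g sigma) a p *: g a p.
Proof.
move=> ap; apply/matrixP => i j; rewrite inner_gradient // !mxE.
under eq_bigr => k _ do rewrite christoffel_conformal // mulrDl [shift _ _ _ _ * _]mulrC.
rewrite big_split /= conformal_shift_contract_up.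
move: (pd a i u p) (pd a j u p) (pd a i sigma p) (pd a j sigma p) (g a p i j).
move: (pd a i _ p) (\sum_(k < n) _) (\sum_(k < n) _).
by move=> *; ring.
Qed.

Lemma ricci_hessian_conformal (u : M -> R) p : dom M a p ->
  ricci gL a p + hessian gL u a p
  = ricci g a p + hessian g u a p - (n%:R - 2) *: hessian g sigma a p
    + (n%:R - 2) *: otimes (diff1 sigma) (diff1 sigma) a p
    - otimes (diff1 u) (diff1 sigma) a p - otimes (diff1 sigma) (diff1 u) a p
    + Psi g u sigma a p *: g a p.
Proof.
move=> ap; rewrite ricci_conformal // hessian_conformal // /Psi.
move: (ricci g a p) (hessian g u a p) (hessian g sigma a p).
move: (otimes _ _ a p) (otimes _ (diff1 u) a p) (otimes (diff1 u) _ a p).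
move: (laplacian _ _ a p) (inner g _ _ a p) (inner g (gradient g u) _ a p) (g a p).
by move=> *; apply/matrixP => i j; rewrite !mxE; ring.
Qed.

End ConformalMetric.

(** * Twisted products *)

(** In the charts [F] is a linear map that sends each basis vector to zero or to a basis vector, so
    a partial derivative of [h \o F] is zero or a partial derivative of [h] composed with [F]. It is
    applied to the two projections of a product. *)
Lemma twice_diff_comp_linear (R : realType) (n m : nat) (M : charted_space R n)
    (N : charted_space R m) (a : chart M) (b : chart N) (F : M -> N)
    (L : {linear 'rV[R]_n -> 'rV[R]_m}) (h : N -> R) :
  open (image_dom a) -> (forall p, dom M a p -> param M a (Defs.coord M a p) = p) ->
  continuous L -> F \o param M a =1 param N b \o L ->
  (forall p, dom M a p -> dom N b (F p)) ->
  (forall p, dom M a p -> Defs.coord N b (F p) = L (Defs.coord M a p)) ->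
  (forall i, L (delta_mx 0 i) = 0 \/ exists j, L (delta_mx 0 i) = delta_mx 0 j) ->
  twice_diff b h -> twice_diff a (h \o F).
Proof.
move=> aopen aK Lc FL Fdom FE Ldelta dh.
have hF (k : N -> R) : (k \o F) \o param M a = (k \o param N b) \o L.
  by apply/funext => x /=; have /= -> := FL x.
have d0 (k : N -> R) p : dom M a p -> diff_at b k (F p) -> diff_at a (k \o F) p.
  move=> ap dk; rewrite /diff_at hF; apply: differentiable_comp.
    exact: linear_differentiable.
  by rewrite -FE.
move=> p ap; have [h0 h1] := dh _ (Fdom p ap); split=> [|i]; first exact: d0.
have pdE q : dom M a q -> pd a i (h \o F) q
    = 'D_(L (delta_mx 0 i)) (h \o param N b) (Defs.coord N b (F q)).
  move=> aq; have [hq _] := dh _ (Fdom q aq).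
  rewrite /pd (deriveE _ (d0 _ _ aq hq)) (deriveE _ hq) hF.
  rewrite diff_comp; [|exact: linear_differentiable|by rewrite -FE].
  by rewrite /= -FE // diff_lin.
have [L0|[j Lj]] := Ldelta i.
  apply: (diff_at_congr aopen aK _ ap (diff_at_cst a 0 p)) => q aq.
  by rewrite pdE // L0 derive0.
apply: (diff_at_congr aopen aK _ ap (d0 _ _ ap (h1 j))) => q aq.
by rewrite (pdE q aq) Lj.
Qed.

Section ProductChart.
Context (R : realType) (n1 n2 : nat).
Context (M1 : charted_space R n1) (M2 : charted_space R n2).
Hypothesis (M1_manifold : smooth_manifold M1) (M2_manifold : smooth_manifold M2).
Local Notation M := (prod_space M1 M2).
Variable a : chart M.

Lemma prod_coordK p : dom M a p -> param M a (Defs.coord M a p) = p.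
Proof.
case: p => p1 p2 [/= ap1 ap2].
by rewrite row_mxKl row_mxKr (coordK M1_manifold ap1) (coordK M2_manifold ap2).
Qed.

Lemma prod_image_dom_open : open (image_dom a).
Proof.
(* The image of a product chart is the product of the two images, written as an intersection of
   preimages under the continuous block projections. *)
have -> : image_dom a =
    (lsubmx @^-1` image_dom a.1) `&` (rsubmx @^-1` image_dom a.2).
  apply/seteqP; split=> x /=.
    move=> [p [ap1 ap2] <-] /=; rewrite row_mxKl row_mxKr.
    by split; [exists p.1|exists p.2].
  move=> [[p1 ap1 E1] [p2 ap2 E2]]; exists (p1, p2) => //=.
  by rewrite E1 E2 hsubmxK.
apply: openI; apply: open_comp.
- by move=> x _; exact: continuous_lsubmx.
- exact: image_dom_open M1_manifold _.
- by move=> x _; exact: continuous_rsubmx.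
- exact: image_dom_open M2_manifold _.
Qed.

Lemma twice_diff_fst (h : M1 -> R) : twice_diff a.1 h ->
  twice_diff a (fun q : M => h q.1).
Proof.
apply: (@twice_diff_comp_linear _ _ _ M M1 a a.1 fst lsubmx h).
- exact: prod_image_dom_open.
- exact: prod_coordK.
- exact: continuous_lsubmx.
- by [].
- by move=> p [].
- by move=> p _ /=; rewrite row_mxKl.
- move=> i; have [i1 ->|i2 ->] := split_ordP i; [right; exists i1|left].
    by apply/rowP => j; rewrite !mxE eq_lshift.
  by apply/rowP => j; rewrite !mxE eq_lrshift andbF.
Qed.

Lemma twice_diff_snd (h : M2 -> R) : twice_diff a.2 h ->
  twice_diff a (fun q : M => h q.2).
Proof.
apply: (@twice_diff_comp_linear _ _ _ M M2 a a.2 snd rsubmx h).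
- exact: prod_image_dom_open.
- exact: prod_coordK.
- exact: continuous_rsubmx.
- by [].
- by move=> p [].
- by move=> p _ /=; rewrite row_mxKr.
- move=> i; have [i1 ->|i2 ->] := split_ordP i; [left|right; exists i2].
    by apply/rowP => j; rewrite !mxE eq_rlshift andbF.
  by apply/rowP => j; rewrite !mxE eq_rshift.
Qed.

Variables (f : M -> R) (g1 : tensor2 M1) (g2 : tensor2 M2).
Hypothesis (g1_metric : pseudo_riemannian g1) (g2_metric : pseudo_riemannian g2).
Hypothesis (f_smooth : smooth_fun f) (f_gt0 : forall p, 0 < f p).
Local Notation g := (twisted_metric f g1 g2).

Lemma twisted_metric_sym p : dom M a p -> (g a p)^T = g a p.
Proof.
move=> [ap1 ap2]; rewrite /twisted_metric tr_block_mx !trmx0 linearZ /=.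
by rewrite (Defs.metric_sym g1_metric ap1) (Defs.metric_sym g2_metric ap2).
Qed.

Lemma twisted_metric_unit p : dom M a p -> g a p \in unitmx.
Proof.
move=> [ap1 ap2]; rewrite /twisted_metric unitmxE det_ublock unitrM -!unitmxE.
rewrite unitmxZ; last by rewrite unitfE expf_neq0 // gt_eqF.
by rewrite (metric_nondegenerate g1_metric ap1) (metric_nondegenerate g2_metric ap2).
Qed.

Lemma twisted_metric_twice_diff i j : twice_diff a (fun q => g a q i j).
Proof.
have aopen := prod_image_dom_open; have aK := prod_coordK.
have d0 : twice_diff a (fun=> 0).
  move=> p ap; split=> [|k]; first exact: diff_at_cst.
  apply: (diff_at_congr aopen aK _ ap (diff_at_cst a 0 p)) => q _.
  by rewrite pd_cst.
have df : twice_diff a f by apply: smooth_twice_diff.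
have [i1 ->|i2 ->] := split_ordP i; have [j1 ->|j2 ->] := split_ordP j.
- rewrite (_ : (fun q => _) = fun q : M => g1 a.1 q.1 i1 j1); last first.
    by apply/funext => q; rewrite block_mxEul.
  apply: (twice_diff_fst (h := fun q => g1 a.1 q i1 j1)).
  apply: smooth_twice_diff; [exact: image_dom_open|exact: coordK|].
  exact: metric_smooth.
- rewrite (_ : (fun q => _) = fun=> 0) //.
  by apply/funext => q; rewrite block_mxEur mxE.
- rewrite (_ : (fun q => _) = fun=> 0) //.
  by apply/funext => q; rewrite block_mxEdl mxE.
- rewrite (_ : (fun q => _) = fun q : M => f q * f q * g2 a.2 q.2 i2 j2); last first.
    by apply/funext => q; rewrite block_mxEdr mxE.
  apply: (twice_diffM aopen aK); first exact: (twice_diffM aopen aK).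
  apply: (twice_diff_snd (h := fun q => g2 a.2 q i2 j2)).
  apply: smooth_twice_diff; [exact: image_dom_open|exact: coordK|].
  exact: metric_smooth.
Qed.

End ProductChart.

Unset Implicit Arguments.

Theorem theorem3p2 (R : realType) (n1 n2 : nat)
    (n1_gt0 : (0 < n1)%N) (n2_gt0 : (0 < n2)%N)
    (M1 : charted_space R n1) (M2 : charted_space R n2)
    (M1_manifold : smooth_manifold M1) (M2_manifold : smooth_manifold M2)
    (g1 : tensor2 M1) (g2 : tensor2 M2)
    (g1_metric : pseudo_riemannian g1) (g2_metric : pseudo_riemannian g2)
    (f phi u lambda : prod_space M1 M2 -> R) (rho : R)
    (f_smooth : smooth_fun f) (f_gt0 : forall p, 0 < f p)
    (phi_smooth : smooth_fun phi) (phi_gt0 : forall p, 0 < phi p)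
    (u_smooth : smooth_fun u) (lambda_smooth : smooth_fun lambda) :
  let M := prod_space M1 M2 in
  let n := (n1 + n2)%N in
  let g := twisted_metric f g1 g2 in
  let sigma := fun p : M => ln (phi p) in
  let gL := scale_metric phi g in
  (forall (a : chart M) (p : M), dom M a p ->
     ricci gL a p + hessian gL u a p
     = (lambda p + rho * scalar_curvature gL a p) *: gL a p)
  <->
  (forall (a : chart M) (p : M), dom M a p ->
     ricci g a p + hessian g u a p
     - (n%:R - 2) *: hessian g sigma a p
     + (n%:R - 2) *: otimes (diff1 sigma) (diff1 sigma) a p
     - otimes (diff1 u) (diff1 sigma) a p
     - otimes (diff1 sigma) (diff1 u) a p
     + Psi g u sigma a p *: g a p
     = (expR (2 * sigma p) * (lambda p + rho * scalar_curvature gL a p))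
       *: g a p).
Proof.
move=> M n g sigma gL.
(* The two left-hand sides are equal as tensors, whether or not either equation holds. *)
have pointwise (a : chart M) (p : M) : dom M a p ->
    ricci gL a p + hessian gL u a p
    = ricci g a p + hessian g u a p
      - (n%:R - 2) *: hessian g sigma a p
      + (n%:R - 2) *: otimes (diff1 sigma) (diff1 sigma) a p
      - otimes (diff1 u) (diff1 sigma) a p
      - otimes (diff1 sigma) (diff1 u) a p
      + Psi g u sigma a p *: g a p.
  apply: ricci_hessian_conformal => //.
  - exact: prod_image_dom_open.
  - exact: prod_coordK.
  - exact: twisted_metric_sym.
  - exact: twisted_metric_unit.
  - exact: twisted_metric_twice_diff.
  - by apply: smooth_twice_diff; [exact: prod_image_dom_open|exact: prod_coordK|].
(* The scalar curvature of [gL] stays unexpanded on both sides, so an arbitrary scalar [c] can stand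
   for the whole factor. *)
have scaled (a : chart M) (p : M) (c : R) :
    c *: gL a p = (expR (2 * sigma p) * c) *: g a p.
  rewrite scalerA mulrC; congr (_ * _ *: _).
  by rewrite expRM_natl lnK ?posrE.
split=> E a p ap.
  by rewrite -pointwise // E // scaled.
by rewrite pointwise // E // scaled.
Qed.
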